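(* Suppose that the set $\Xi$ is finite and $\Xi\cap\mathcal{B}=\emptyset$ (with $\mathcal{B}$ as in the context). For each $i=1,\dots,m$, the locational marginal value of initial investment in storage capacity at node $i$, $\mathsf{LMV}^i=-\frac{\partial J^*(b)}{\partial b^i}\big|_{b=0^+}$, is given by $$\mathsf{LMV}^i=\mathbb{E}\left[\sum_{k=0}^{N-2}\big(\lambda^i_{k+1|k}-\lambda^i_k\big)^+\right].$$ Moreover, it is bounded from above as $$\mathsf{LMV}^i\le \frac12\,\mathbb{E}\big[\mathsf{TV}(\lambda^i)\big]+\frac12\,\mathbb{E}\big[\lambda^i_{N-1}-\lambda^i_0\big].$$
   Context: Network. A power network is a connected undirected graph on $m$ nodes $1,\dots,m$ with $\ell$ edges (transmission lines). The line joining $i$ and $j$ has susceptance $y^{ij}=y^{ji}\neq 0$ ($y^{ij}=0$ if $i\ne j$ are not joined by a line), and $y^{ii}$ is the susceptance of the shunt element at node $i$. Let $Y \in \mathbb{R}^{m\times m}$ with $Y^{ij}=-y^{ij}$ for $i\ne j$ and $Y^{ii}=y^{ii}+\sum_{j\neq i} y^{ij}$. Let $B\in\mathbb{R}^{\ell\times m}$ be the weighted incidence matrix: for line $k$ joining $i$ and $j$, $B^{ki}=-B^{kj}=y^{ij}$ and $B^{kr}=0$ for $r\ne i,j$. Let $f\in\mathbb{R}_+^\ell$ be the vector of line capacities. The injection polytope is $\mathcal{P}=\{x\in\mathbb{R}^m : x=Y\theta,\ -f\le B\theta\le f \text{ for some }\theta\in\mathbb{R}^m\}$. Costs. For $x\in\mathbb{R}$,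 $x^+=\max\{x,0\}$. For constants $\alpha^i\ge\beta^i\ge 0$, let $g^i(v^i)=\alpha^i (v^i)^+-\beta^i(-v^i)^+$ and $g(v)=\sum_{i=1}^m g^i(v^i)$ for $v\in\mathbb{R}^m$. Net demand. $\{\xi_0,\dots,\xi_{N-1}\}$ is a random process with known joint distribution, each $\xi_k$ taking values in $\Xi\subset\mathbb{R}^m$ (no stationarity or independence is assumed). Storage and policies. For $b\in\mathbb{R}_+^m$ let $\mathcal{Z}(b)=\{z\in\mathbb{R}^m_+ : 0\le z\le b\}$. Storage states evolve as $z_{k+1}=z_k+u_k$, $k=0,\dots,N-1$, $z_0=0$. With information $I_k=(z_{\le k},\xi_{\le k})$, where $x_{\le k}=(x_0,\dots,x_k)$, a control policy $\pi=((\mu_0,\nu_0),\dots,(\mu_{N-1},\nu_{N-1}))$ gives $u_k=\mu_k(I_k)\in\mathbb{R}^m$, $v_k=\nu_k(I_k)\in\mathbb{R}^m$. It is admissible ($\pi\in\Pi(b)$) if $z_k+\mu_k(I_k)\in\mathcal{Z}(b)$ and $\nu_k(I_k)-\mu_k(I_k)-\xi_k\in\mathcal{P}$ almost surely for each $k=0,\dots,N-1$. Set $J^\pi(b)=\mathbb{E}\big[\sum_{k=0}^{N-1} g(\nu_k(I_k))\big]$ and $J^*(b)=\inf\{J^\pi(b):\pi\in\Pi(b)\}$. Here $\frac{\partial J^*(b)}{\partial b^i}\big|_{b=0^+}$ is the right-hand derivative of $J^*$ with respect to the $i$-th coordinate at $b=0$ (it exists by convexity of $J^*$). Single-period dispatch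 and prices. For $\xi\in\mathbb{R}^m$ let $Q(\xi)=\inf\{g(v): v\in\mathbb{R}^m,\ v-\xi\in\mathcal{P}\}$; standing assumption: this problem is feasible and the infimum is attained for every $\xi\in\mathbb{R}^m$. Writing the constraint as $v-\xi=Y\theta$, $-f\le B\theta\le f$, let $\lambda(\xi)\in\mathbb{R}^m$ be an optimal Lagrange multiplier of the power balance constraint $v-\xi=Y\theta$, with the sign convention that the Lagrangian contains the term $-\lambda^\top(v-\xi-Y\theta)$ (so $\lambda(\xi)$ measures the marginal cost of increasing $\xi$). Partition. Fix a full-dimensional polytope $\mathcal{K}\subset\mathbb{R}^m$ with $\Xi\subset\mathrm{int}(\mathcal{K})$, and a polyhedral partition $\mathcal{L}=\{\mathcal{S}_1,\dots,\mathcal{S}_{|\mathcal{L}|}\}$ of $\mathcal{K}$ (a finite collection of polyhedral sets with union $\mathcal{K}$ and pairwise disjoint interiors) such that: $Q$ is affine on each $\mathcal{S}_j$; on each $\mathrm{int}(\mathcal{S}_j)$, $\lambda(\cdot)$ is nonnegative and constant and $\nabla Q=\lambda$; and $\mathcal{B}:=\bigcup_{j}\partial\mathcal{S}_j$ has zero Lebesgue measure. (Such a partition exists.) Here $\partial\mathcal{S}=\mathcal{S}\setminus\mathrm{int}(\mathcal{S})$. When $\Xi\cap\mathcal{B}=\emptyset$, $\lambda(\xi)$ is uniquely defined for all $\xi\in\Xi$. Price process. $\lambda_k=\lambda(\xi_k)$ with $i$-th entry $\lambda_k^i=\lambda^i(\xi_k)$, $k=0,\dots,N-1$; $\lambda^i=(\lambda_0^i,\dots,\lambda_{N-1}^i)$;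 and $\lambda_{k+1|k}=\mathbb{E}[\lambda_{k+1}\mid\xi_{\le k}]\in\mathbb{R}^m$ with $i$-th entry $\lambda^i_{k+1|k}$, $k=0,\dots,N-2$. For a scalar sequence $x=(x_0,\dots,x_{N-1})$, $\mathsf{TV}(x)=\sum_{k=0}^{N-2}|x_{k+1}-x_k|$. *)

(* Defs.v *)
From HB Require Import structures.
From mathcomp Require Import all_boot all_order all_algebra.
From mathcomp Require Import all_classical all_reals all_analysis.
Set Implicit Arguments.
Unset Strict Implicit.
Unset Printing Implicit Defensive.
Import Order.TTheory GRing.Theory Num.Theory.
Import numFieldNormedType.Exports.
Local Open Scope classical_set_scope.
Local Open Scope ring_scope.

(* Vectors of R^m are column vectors; the diagonal entry [susc i i] is the
   susceptance of the shunt element at node i.  The orientation src -> dst of a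
   line is arbitrary and only fixes the sign of its row in the incidence
   matrix. *)
Record network (R : realType) (m l : nat) := Network {
  susc : 'M[R]_m;
  src : 'I_l -> 'I_m;
  dst : 'I_l -> 'I_m;
  susc_sym : forall i j, susc i j = susc j i;
  line_neq : forall k, src k != dst k;
  line_inj : injective (fun k => [set src k; dst k]%SET);
  lineP : forall i j, i != j ->
    (susc i j != 0 <-> exists k, [set src k; dst k]%SET = [set i; j]%SET);
  net_connected : forall i j,
    connect (fun i' j' => (i' != j') && (susc i' j' != 0)) i j
}.

Definition admittance (R : realType) (m l : nat) (G : network R m l) : 'M[R]_m :=
  \matrix_(i, j) if i == j then susc G i i + \sum_(r | r != i) susc G i r
                 else - susc G i j.

Definition incidence (R : realType) (m l : nat) (G : network R m l) :
    'M[R]_(l, m) :=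
  \matrix_(k, r) if r == src G k then susc G (src G k) (dst G k)
                 else if r == dst G k then - susc G (src G k) (dst G k)
                 else 0.

Definition injection_polytope (R : realType) (m l : nat) (G : network R m l)
    (f : 'cV[R]_l) : set 'cV[R]_m :=
  [set x | exists theta : 'cV[R]_m, x = admittance G *m theta /\
     forall k, - f k 0 <= (incidence G *m theta) k 0 <= f k 0].

Definition pos (R : realType) (x : R) : R := Num.max x 0.

Definition cost (R : realType) (m : nat) (alpha beta : 'I_m -> R)
    (v : 'cV[R]_m) : R :=
  \sum_(i < m) (alpha i * pos (v i 0) - beta i * pos (- v i 0)).

Definition dispatch_feasible (R : realType) (m l : nat) (G : network R m l)
    (f : 'cV[R]_l) (xi : 'cV[R]_m) : set 'cV[R]_m :=
  [set v | injection_polytope G f (v - xi)].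

(* Feasibility and attainment of the dispatch problem at xi; under it, the real
   infimum [dispatch_value] below is the true infimum. *)
Definition dispatch_attained (R : realType) (m l : nat) (G : network R m l)
    (f : 'cV[R]_l) (alpha beta : 'I_m -> R) (xi : 'cV[R]_m) : Prop :=
  exists v, dispatch_feasible G f xi v /\
    forall v', dispatch_feasible G f xi v' -> cost alpha beta v <= cost alpha beta v'.

Definition dispatch_value (R : realType) (m l : nat) (G : network R m l)
    (f : 'cV[R]_l) (alpha beta : 'I_m -> R) (xi : 'cV[R]_m) : R :=
  inf (cost alpha beta @` dispatch_feasible G f xi).

Definition dotv (R : realType) (n : nat) (x y : 'cV[R]_n) : R :=
  \sum_(i < n) x i 0 * y i 0.

Definition lagrangian (R : realType) (m l : nat) (G : network R m l)
    (f : 'cV[R]_l) (alpha beta : 'I_m -> R) (xi : 'cV[R]_m)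
    (lam : 'cV[R]_m) (etam etap : 'cV[R]_l) (v theta : 'cV[R]_m) : R :=
  cost alpha beta v - dotv lam (v - xi - admittance G *m theta)
  + dotv etam (- f - incidence G *m theta)
  + dotv etap (incidence G *m theta - f).

Definition dual_function (R : realType) (m l : nat) (G : network R m l)
    (f : 'cV[R]_l) (alpha beta : 'I_m -> R) (xi : 'cV[R]_m)
    (lam : 'cV[R]_m) (etam etap : 'cV[R]_l) : \bar R :=
  ereal_inf [set e | exists v theta,
    e = (lagrangian G f alpha beta xi lam etam etap v theta)%:E].

Definition nonneg_vec (R : realType) (n : nat) (x : 'cV[R]_n) : Prop :=
  forall i, 0 <= x i 0.

(* lam is the power-balance component of an optimal dual solution. *)
Definition optimal_multiplier (R : realType) (m l : nat) (G : network R m l)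
    (f : 'cV[R]_l) (alpha beta : 'I_m -> R) (xi lam : 'cV[R]_m) : Prop :=
  exists etam etap : 'cV[R]_l, nonneg_vec etam /\ nonneg_vec etap /\
    forall (lam' : 'cV[R]_m) (etam' etap' : 'cV[R]_l),
      nonneg_vec etam' -> nonneg_vec etap' ->
      (dual_function G f alpha beta xi lam' etam' etap'
       <= dual_function G f alpha beta xi lam etam etap)%E.

Definition polyhedral (R : realType) (m : nat) (S : set 'cV[R]_m) : Prop :=
  exists (n : nat) (A : 'M[R]_(n, m)) (c : 'cV[R]_n),
    S = [set x | forall r, (A *m x) r 0 <= c r 0].

Definition boundary (R : realType) (m : nat) (S : set 'cV[R]_m) : set 'cV[R]_m :=
  S `\` S°.

(* Lebesgue-null sets of R^m, by countable covers with boxes of arbitrarily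
   small total volume. *)
Definition lebesgue_null (R : realType) (m : nat) (A : set 'cV[R]_m) : Prop :=
  forall eps : R, 0 < eps ->
  exists lo hi : nat -> 'cV[R]_m,
    (forall n i, lo n i 0 <= hi n i 0) /\
    A `<=` \bigcup_n [set x | forall i, lo n i 0 <= x i 0 <= hi n i 0] /\
    (\sum_(0 <= n <oo) (\prod_(i < m) (hi n i 0 - lo n i 0))%:E <= eps%:E)%E.

Definition partition_boundary (R : realType) (m nL : nat)
    (S : 'I_nL -> set 'cV[R]_m) : set 'cV[R]_m :=
  \bigcup_j boundary (S j).

Record price_partition (R : realType) (m nL : nat) (Q : 'cV[R]_m -> R)
    (lam : 'cV[R]_m -> 'cV[R]_m) (K : set 'cV[R]_m)
    (S : 'I_nL -> set 'cV[R]_m) : Prop := PricePartition {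
  pp_polytope : polyhedral K /\ bounded_set K;
  pp_full_dim : K° !=set0;
  pp_pieces : forall j, polyhedral (S j);
  pp_cover : \bigcup_j S j = K;
  pp_disjoint : forall j j', j != j' -> (S j)° `&` (S j')° = set0;
  pp_affine : forall j, exists (a : 'cV[R]_m) (c : R),
    forall x, S j x -> Q x = dotv a x + c;
  pp_nonneg : forall j x, (S j)° x -> nonneg_vec (lam x);
  pp_const : forall j x x', (S j)° x -> (S j)° x' -> lam x = lam x';
  pp_grad : forall j x, (S j)° x -> is_diff x Q (dotv (lam x));
  pp_null : lebesgue_null (partition_boundary S)
}.

(* At stage k the policy receives I_k = ((z_0, .., z_k), (xi_0, .., xi_k));
   over a horizon of N stages only the components k < N are used. *)
Record policy (R : realType) (m : nat) := Policy {
  ctrl_u : forall k : nat,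
    k.+1.-tuple 'cV[R]_m -> k.+1.-tuple 'cV[R]_m -> 'cV[R]_m;
  ctrl_v : forall k : nat,
    k.+1.-tuple 'cV[R]_m -> k.+1.-tuple 'cV[R]_m -> 'cV[R]_m
}.

Definition demand_hist (R : realType) (m : nat) (d : nat -> 'cV[R]_m) (k : nat) :
    k.+1.-tuple 'cV[R]_m :=
  [tuple d j | j < k.+1].

(* (z_0, .., z_k) along the demand path d: z_0 = 0, z_(k+1) = z_k + u_k. *)
Fixpoint storage_hist (R : realType) (m : nat) (pi : policy R m)
    (d : nat -> 'cV[R]_m) (k : nat) : k.+1.-tuple 'cV[R]_m :=
  match k return k.+1.-tuple 'cV[R]_m with
  | 0%N => [tuple 0]
  | k'.+1 => let z := storage_hist pi d k' in
      [tuple of rcons z (tnth z ord_max + ctrl_u pi z (demand_hist d k'))]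
  end.

Definition storage (R : realType) (m : nat) (pi : policy R m)
    (d : nat -> 'cV[R]_m) (k : nat) : 'cV[R]_m :=
  tnth (storage_hist pi d k) ord_max.

Definition u_of (R : realType) (m : nat) (pi : policy R m)
    (d : nat -> 'cV[R]_m) (k : nat) : 'cV[R]_m :=
  ctrl_u pi (storage_hist pi d k) (demand_hist d k).

Definition v_of (R : realType) (m : nat) (pi : policy R m)
    (d : nat -> 'cV[R]_m) (k : nat) : 'cV[R]_m :=
  ctrl_v pi (storage_hist pi d k) (demand_hist d k).

Definition storage_set (R : realType) (m : nat) (b : 'cV[R]_m) : set 'cV[R]_m :=
  [set z | forall i, 0 <= z i 0 <= b i 0].

Definition admissible (d : measure_display) (T : measurableType d) (R : realType)
    (P : probability T R) (m l N : nat) (G : network R m l) (f : 'cV[R]_l)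
    (xi : nat -> T -> 'cV[R]_m) (b : 'cV[R]_m) (pi : policy R m) : Prop :=
  forall k, (k < N)%N -> \forall w \ae P,
    storage_set b (storage pi (xi ^~ w) k + u_of pi (xi ^~ w) k) /\
    injection_polytope G f
      (v_of pi (xi ^~ w) k - u_of pi (xi ^~ w) k - xi k w).

Definition policy_cost (d : measure_display) (T : measurableType d) (R : realType)
    (P : probability T R) (m N : nat) (alpha beta : 'I_m -> R)
    (xi : nat -> T -> 'cV[R]_m) (pi : policy R m) : \bar R :=
  'E_P[fun w => (\sum_(k < N) cost alpha beta (v_of pi (xi ^~ w) k))%R]%E.

Definition optimal_cost (d : measure_display) (T : measurableType d) (R : realType)
    (P : probability T R) (m l N : nat) (G : network R m l) (f : 'cV[R]_l)
    (alpha beta : 'I_m -> R) (xi : nat -> T -> 'cV[R]_m) (b : 'cV[R]_m) : \bar R :=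
  ereal_inf (policy_cost P N alpha beta xi @` admissible P N G f xi b).

(* Difference quotient at 0 along coordinate i; the infinite cases of \bar R
   cannot produce a finite limit, so its convergence to a real number entails
   that F is finite at 0 and at t *: e_i for small t > 0. *)
Definition coord_quotient (R : realType) (m : nat) (F : 'cV[R]_m -> \bar R)
    (i : 'I_m) (t : R) : \bar R :=
  ((F (t *: delta_mx i 0)%R - F 0%R) * (t^-1)%:E)%E.

Definition right_partial0 (R : realType) (m : nat) (F : 'cV[R]_m -> \bar R)
    (i : 'I_m) : \bar R :=
  lim (coord_quotient F i t @[t --> 0^'+]).

(* The sigma-algebra generated by xi_0, .., xi_k. *)
Definition past_sigma (d : measure_display) (T : measurableType d) (R : realType)
    (m : nat) (xi : nat -> T -> 'cV[R]_m) (k : nat) : set (set T) :=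
  <<s [set A | exists (j : nat) (r : 'I_m) (B : set R), (j <= k)%N /\
         measurable B /\ A = (fun w => xi j w r 0) @^-1` B] >>.

(* Y is a version of E[X | xi_0, .., xi_k]. *)
Definition is_cond_exp (d : measure_display) (T : measurableType d) (R : realType)
    (P : probability T R) (m : nat) (xi : nat -> T -> 'cV[R]_m) (k : nat)
    (X Y : T -> R) : Prop :=
  [/\ forall B : set R, measurable B -> past_sigma xi k (Y @^-1` B),
      P.-integrable setT (EFin \o Y) &
      forall A, past_sigma xi k A ->
        (\int[P]_(w in A) (Y w)%:E = \int[P]_(w in A) (X w)%:E)%E].

Definition total_variation_seq (R : realType) (N : nat) (x : nat -> R) : R :=
  \sum_(k < N.-1) `|x k.+1 - x k|.

(* Main.v *)
(* As Xi is finite and avoids the partition boundary, Q is affine with slope lam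
   on a ball of uniform radius around each demand value.  For a small capacity t
   at node i, a storage path z thus costs sum_k Q(xi_k) plus
   sum_k lam_k (z_(k+1) - z_k); summing by parts and conditioning on the past
   turns the expectation of the latter into
   E[lam_(N-1) z_N] - E[sum_k (lam_(k+1|k) - lam_k) z_(k+1)].
   Since lam >= 0 and 0 <= z <= t, it is minimized by filling the storage exactly
   when the expected price increases, so J* is affine in t near 0.  All expectations
   are finite sums over the finitely many demand paths. *)

Require Import Defs.
From HB Require Import structures.
From mathcomp Require Import all_boot all_order all_algebra.
From mathcomp Require Import all_classical all_reals all_analysis.
From mathcomp Require Import measurable_realfun ring lra.
Set Implicit Arguments.
Unset Strict Implicit.
Unset Printing Implicit Defensive.
Import Order.TTheory GRing.Theory Num.Theory.
Import numFieldNormedType.Exports.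
Local Open Scope classical_set_scope.
Local Open Scope ring_scope.

(** * Expectations of functions of a finite-valued code *)

(** The event is a finite disjoint union of fibres of [h], and the integrand is constant on each.
    Measurability is asked of fibres only, as [F] carries no sigma-algebra. *)
Lemma integral_finite_code (d : measure_display) (T : measurableType d)
    (R : realType) (P : probability T R) (F : finType) (h : T -> F)
    (mh : forall x, measurable (h @^-1` [set x])) (B : pred F) (phi : F -> R) :
  (\int[P]_(w in [set w | B (h w)]) (phi (h w))%:E =
   (\sum_(x | B x) fine (P (h @^-1` [set x])) * phi x)%:E)%E.
Proof.
have -> : [set w | B (h w)] =
    \big[setU/set0]_(x <- enum B) (h @^-1` [set x]).
  rewrite -bigcup_seq; apply/seteqP; split => w /=.
    by move=> Bw; exists (h w) => //=; rewrite mem_enum.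
  by case=> x /=; rewrite mem_enum => Bx ->.
rewrite integral_bigsetU_EFin//.
- rewrite big_enum/= -sumEFin; apply: eq_bigr => x _.
  rewrite (@eq_integral _ _ _ P _ (cst (phi x)%:E)).
    rewrite integral_cst// muleC EFinM fineK//.
    exact: fin_num_measure.
  by move=> w; rewrite inE => hw; congr (phi _)%:E; exact: hw.
- exact: enum_uniq.
- apply/trivIsetP => x y _ _ /eqP xy; apply/seteqP; split => w //= [hx hy].
  by apply: xy; rewrite -hx.
- apply: (@measurable_funS _ _ _ _ setT) => //.
  apply/measurable_EFinP => _ Y mY; rewrite setTI.
  have -> : (fun w => phi (h w)) @^-1` Y =
      \big[setU/set0]_(x <- enum [pred x | `[< Y (phi x) >]])
        (h @^-1` [set x]).
    rewrite -bigcup_seq; apply/seteqP; split => w /=.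
      by move=> Yw; exists (h w) => //=; rewrite mem_enum; apply/asboolP.
    by case=> x /=; rewrite mem_enum => /asboolP Yx ->.
  exact: bigsetU_measurable.
Qed.

Lemma expectation_finite_code (d : measure_display) (T : measurableType d)
    (R : realType) (P : probability T R) (F : finType) (h : T -> F)
    (mh : forall x, measurable (h @^-1` [set x])) (X : T -> R) (phi : F -> R) :
  (forall w, X w = phi (h w)) ->
  ('E_P[X] = (\sum_x fine (P (h @^-1` [set x])) * phi x)%:E)%E.
Proof.
move=> /funext ->; rewrite unlock -(integral_finite_code P mh predT).
by congr integral; apply/seteqP; split.
Qed.

(** A fibre over a point where [A] fails is negligible. This turns almost sure constraints into
    constraints on every code of positive weight. *)
Lemma ae_finite_code (d : measure_display) (T : measurableType d)
    (R : realType) (P : probability T R) (F : finType) (h : T -> F)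
    (mh : forall x, measurable (h @^-1` [set x])) (A : F -> Prop) :
  (\forall w \ae P, A (h w)) ->
  forall x, fine (P (h @^-1` [set x])) != 0 -> A x.
Proof.
move=> Aae x; apply: contra_neqP => nAx.
have /negligibleS/(_ Aae) : h @^-1` [set x] `<=` ~` [set w | A (h w)].
  by move=> w /= ->.
by move=> /measure_negligible ->.
Qed.

(** * Gains from trading along demand paths *)

Lemma abel_sum (R : realType) (N : nat) (q z : nat -> R) : z 0%N = 0 ->
  \sum_(k < N.+1) q k * (z k.+1 - z k) =
  q N * z N.+1 - \sum_(k < N) (q k.+1 - q k) * z k.+1.
Proof.
move=> z0; elim: N => [|N IH]; first by rewrite big_ord_recl !big_ord0 z0 /=; ring.
by rewrite big_ord_recr/= IH [in RHS]big_ord_recr/=; ring.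
Qed.

(* [past k x] forgets everything that path [x] reveals after stage [k];
   [hat k] is the conditional expectation of [price k.+1] given stage [k]. *)
Section PathModel.
Variables (R : realType) (F : finType) (p : F -> R) (past : nat -> F -> F).
Variables (N : nat) (price hat : nat -> F -> R).
Hypothesis p_ge0 : forall x, 0 <= p x.
Hypothesis price_past : forall k x, price k (past k x) = price k x.
Hypothesis hat_past : forall k x, hat k (past k x) = hat k x.
Hypothesis tower : forall k (phi : F -> R), (k < N)%N ->
  (forall x, phi (past k x) = phi x) ->
  \sum_x p x * (price k.+1 x * phi x) = \sum_x p x * (hat k x * phi x).

Definition lmv_sum : R := \sum_x p x * \sum_(k < N) pos (hat k x - price k x).

(** The level [z k.+1] is decided at stage [k]: its invariance under [past k] makes it a valid test
    function in [tower], which replaces the next price by its forecast. *)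
Lemma trading_sum (z : nat -> F -> R) :
  (forall x, z 0%N x = 0) -> (forall k x, z k.+1 (past k x) = z k.+1 x) ->
  \sum_x p x * \sum_(k < N.+1) price k x * (z k.+1 x - z k x) =
  \sum_x p x * (price N x * z N.+1 x) -
  \sum_x p x * \sum_(k < N) (hat k x - price k x) * z k.+1 x.
Proof.
move=> z0 zp.
under eq_bigr => x _ do
  rewrite (@abel_sum _ N (price ^~ x) (z ^~ x) (z0 x)) mulrBr.
rewrite sumrB; congr (_ - _).
under eq_bigr => x _ do rewrite mulr_sumr.
under [RHS]eq_bigr => x _ do rewrite mulr_sumr.
rewrite exchange_big [RHS]exchange_big; apply: eq_bigr => k _ /=.
under eq_bigr => x _ do rewrite mulrBl mulrBr.
under [RHS]eq_bigr => x _ do rewrite mulrBl mulrBr.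
by rewrite !sumrB tower.
Qed.

(** The terminal term is nonnegative, and each product [(hat - price) * z] is at most
    [pos (hat - price) * t]. The bounds on price and storage are asked only where [p x != 0], since
    admissibility holds almost surely. *)
Lemma trading_sum_ge (t : R) (z : nat -> F -> R) :
  (forall x, p x != 0 -> 0 <= price N x) ->
  (forall x, z 0%N x = 0) -> (forall k x, z k.+1 (past k x) = z k.+1 x) ->
  (forall k x, p x != 0 -> (k <= N)%N -> 0 <= z k.+1 x <= t) ->
  - (t * lmv_sum) <= \sum_x p x * \sum_(k < N.+1) price k x * (z k.+1 x - z k x).
Proof.
move=> price_ge0 z0 zp zt; rewrite trading_sum// -[leLHS]add0r.
have p_gt0 x : p x != 0 -> 0 < p x by rewrite lt_neqAle eq_sym p_ge0 andbT.
apply: lerB.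
  apply: sumr_ge0 => x _; have [->|px] := eqVneq (p x) 0; first by rewrite mul0r.
  by rewrite mulr_ge0// mulr_ge0 ?price_ge0//; case/andP: (zt N x px (leqnn _)).
rewrite /lmv_sum mulr_sumr; apply: ler_sum => x _.
have [->|px] := eqVneq (p x) 0; first by rewrite !mul0r mulr0.
rewrite mulrCA ler_pM2l ?p_gt0// mulr_sumr; apply: ler_sum => k _.
have /andP[zk0 zkt] := zt k x px (ltnW (ltn_ord k)).
rewrite [leRHS]mulrC; apply: (@le_trans _ _ (pos (hat k x - price k x) * z k.+1 x)).
  by rewrite ler_wpM2r// /pos le_max lexx.
by rewrite ler_wpM2l// /pos le_max lexx orbT.
Qed.

(** Filling exactly when the forecast exceeds the price attains the lower bound; the test [k < N]
    empties the storage at the end, which kills the terminal term. *)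
Lemma trading_sum_threshold (t : R) (z : nat -> F -> R) :
  (forall x, z 0%N x = 0) -> (forall k x, z k.+1 x =
    if (k < N)%N && (price k x < hat k x) then t else 0) ->
  \sum_x p x * \sum_(k < N.+1) price k x * (z k.+1 x - z k x) = - (t * lmv_sum).
Proof.
move=> z0 zE; rewrite trading_sum//; last by move=> k x; rewrite !zE price_past hat_past.
rewrite big1 ?sub0r; last by move=> x _; rewrite zE ltnn mulr0 mulr0.
congr (- _); rewrite /lmv_sum mulr_sumr; apply: eq_bigr => x _.
rewrite mulrCA; congr (_ * _); rewrite mulr_sumr; apply: eq_bigr => k _.
rewrite zE ltn_ord/= /pos; case: ltP => ph.
  by rewrite max_l 1?mulrC// subr_ge0 ltW.
by rewrite max_r ?mulr0// subr_le0.
Qed.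

(* Jensen's inequality for the positive part, tested on the event
   [price k < hat k]. *)
Lemma lmv_sum_le : lmv_sum <=
  2^-1 * (\sum_x p x * \sum_(k < N) `|price k.+1 x - price k x|) +
  2^-1 * (\sum_x p x * (price N x - price 0%N x)).
Proof.
have -> : lmv_sum = \sum_(k < N) \sum_x
    p x * ((price k.+1 x - price k x) * (price k x < hat k x)%R%:R).
  rewrite /lmv_sum; under eq_bigr => x _ do rewrite mulr_sumr.
  rewrite exchange_big; apply: eq_bigr => k _ /=.
  under [RHS]eq_bigr => x _ do rewrite mulrBl mulrBr.
  rewrite sumrB (tower (ltn_ord k)); last by move=> x; rewrite price_past hat_past.
  rewrite -sumrB; apply: eq_bigr => x _.
  rewrite -mulrBr -mulrBl /pos; congr (_ * _); case: ltP => ph.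
    by rewrite mulr1 max_l// subr_ge0 ltW.
  by rewrite mulr0 max_r// subr_le0.
rewrite exchange_big/= !mulr_sumr -big_split; apply: ler_sum => x _ /=.
rewrite mulrCA [X in _ <= _ + X]mulrCA -mulrDr -mulr_sumr ler_wpM2l//.
(* The endpoint difference telescopes, leaving a comparison of increments: an increment [a], whether
   kept or dropped, contributes at most [(|a| + a) / 2]. *)
rewrite -(telescope_sumr (price ^~ x) (leq0n N)) big_mkord -mulrDr -big_split.
rewrite mulr_sumr; apply: ler_sum => k _ /=.
have := ler_norm (price k.+1 x - price k x).
have := normr_ge0 (price k.+1 x - price k x).
have := ler_norm (- (price k.+1 x - price k x)); rewrite normrN.
by case: (price k x < hat k x); rewrite ?mulr1 ?mulr0; lra.
Qed.

End PathModel.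

(** * Dispatch value and its local slope *)

Lemma dispatch_value_le (R : realType) (m l : nat) (G : network R m l)
    (f : 'cV[R]_l) (alpha beta : 'I_m -> R) (x v : 'cV[R]_m) :
  dispatch_attained G f alpha beta x -> dispatch_feasible G f x v ->
  dispatch_value G f alpha beta x <= cost alpha beta v.
Proof.
move=> [v0 [_ v0min]] xv; apply: ge_inf; last by exists v.
by exists (cost alpha beta v0) => _ [v' xv' <-]; exact: v0min.
Qed.

Lemma dispatch_value_attained (R : realType) (m l : nat) (G : network R m l)
    (f : 'cV[R]_l) (alpha beta : 'I_m -> R) (x : 'cV[R]_m) :
  dispatch_attained G f alpha beta x ->
  exists2 v, dispatch_feasible G f x v &
    cost alpha beta v = dispatch_value G f alpha beta x.
Proof.
move=> x_att; have [v [xv vmin]] := x_att; exists v => //; apply/le_anti/andP.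
split; last exact: dispatch_value_le.
apply: lb_le_inf; first by exists (cost alpha beta v), v.
by move=> _ [v' xv' <-]; exact: vmin.
Qed.

(** The slope [a] of the piece is not assumed to be the gradient [g]; both compute the derivative of
    [Q] at [x] along axis [i], hence agree in entry [i]. *)
Lemma affine_along_axis (R : realType) (m : nat) (Q : 'cV[R]_m -> R)
    (U : set 'cV[R]_m) (a : 'cV[R]_m) (c : R) (x g : 'cV[R]_m) (i : 'I_m) :
  U° x -> (forall y, U y -> Q y = dotv a y + c) -> is_diff x Q (dotv g) ->
  exists2 e : R, 0 < e &
    forall s, `|s| < e -> Q (x + s *: delta_mx i 0) = Q x + g i 0 * s.
Proof.
move=> Ux QU Qx.
have dotvD s : dotv a (x + s *: delta_mx i 0) = dotv a x + a i 0 * s.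
  rewrite /dotv (bigD1 i)//= [in RHS](bigD1 i)//= !mxE !eqxx mulr1.
  rewrite mulrDr addrAC; congr (_ + _ + _); apply: eq_bigr => j /negbTE ji.
  by rewrite !mxE ji mulr0 addr0.
have dotvg : dotv g (delta_mx i 0) = g i 0.
  rewrite /dotv (bigD1 i)//= !mxE !eqxx mulr1 big1 ?addr0// => j /negbTE ji.
  by rewrite !mxE ji mulr0.
have [e /= e0 eU] : exists2 e : R, 0 < e & forall s, `|s| < e ->
    U (x + s *: delta_mx i 0).
  have /nbhs_ballP[e /= e0 eU] : nbhs x U by [].
  exists e => // s se; apply: eU; split => // r q; rewrite /ball/= !mxE.
  rewrite opprD addNKr normrN normrM; case: (_ && _); last by rewrite normr0 mulr0.
  by rewrite normr1 mulr1.
have Ux0 : U x by have := eU 0; rewrite normr0 scale0r addr0; exact.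
have axis s : `|s| < e -> Q (x + s *: delta_mx i 0) = Q x + a i 0 * s.
  by move=> se; rewrite !QU ?dotvD//; [rewrite addrAC|exact: eU].
suff -> : g i 0 = a i 0 by exists e.
rewrite -dotvg; have <- : 'd Q x = dotv g :> (_ -> _) by exact: diff_val.
rewrite -deriveE; last exact: ex_diff.
(* Near 0 the difference quotient is constantly [a i 0], and so is its limit. *)
apply: lim_near_cst => //; near=> h; rewrite /= [_ *: _ + x]addrC axis.
  rewrite addrAC subrr add0r /GRing.scale/= mulrCA mulVf ?mulr1//.
  near: h; exact: nbhs_dnbhs_neq.
near: h; apply: dnbhs0_lt; exact: e0.
Unshelve. all: by end_near. Qed.

(** * Causality of storage and controls *)

Lemma demand_hist_eq (R : realType) (m : nat) (d d' : nat -> 'cV[R]_m) (k : nat) :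
  (forall j, (j <= k)%N -> d j = d' j) -> demand_hist d k = demand_hist d' k.
Proof. by move=> dd'; apply: eq_mktuple => j; apply: dd'; rewrite -ltnS. Qed.

(** The bound on [j] is strict because levels up to stage [k] result from controls chosen before
    stage [k]. *)
Lemma storage_hist_eq (R : realType) (m : nat) (pi : policy R m)
    (d d' : nat -> 'cV[R]_m) (k : nat) :
  (forall j, (j < k)%N -> d j = d' j) ->
  storage_hist pi d k = storage_hist pi d' k.
Proof.
elim: k => [//|k IH] dd' /=.
by rewrite IH ?(demand_hist_eq dd')// => j jk; apply: dd'; exact: ltnW.
Qed.

Lemma storage0 (R : realType) (m : nat) (pi : policy R m) (d : nat -> 'cV[R]_m) :
  storage pi d 0 = 0.
Proof. by []. Qed.

Lemma storageS (R : realType) (m : nat) (pi : policy R m) (d : nat -> 'cV[R]_m)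
    (k : nat) : storage pi d k.+1 = storage pi d k + u_of pi d k.
Proof.
by rewrite {1}/storage (tnth_nth 0)/= nth_rcons size_tuple ltnn eqxx.
Qed.

Lemma storage_eq (R : realType) (m : nat) (pi : policy R m)
    (d d' : nat -> 'cV[R]_m) (k : nat) :
  (forall j, (j < k)%N -> d j = d' j) -> storage pi d k = storage pi d' k.
Proof. by move=> dd'; rewrite /storage (storage_hist_eq pi dd'). Qed.

Lemma u_of_eq (R : realType) (m : nat) (pi : policy R m)
    (d d' : nat -> 'cV[R]_m) (k : nat) :
  (forall j, (j <= k)%N -> d j = d' j) -> u_of pi d k = u_of pi d' k.
Proof.
move=> dd'; rewrite /u_of (demand_hist_eq dd') (@storage_hist_eq _ _ pi d d')//.
by move=> j jk; apply: dd'; exact: ltnW.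
Qed.

Lemma v_of_eq (R : realType) (m : nat) (pi : policy R m)
    (d d' : nat -> 'cV[R]_m) (k : nat) :
  (forall j, (j <= k)%N -> d j = d' j) -> v_of pi d k = v_of pi d' k.
Proof.
move=> dd'; rewrite /v_of (demand_hist_eq dd') (@storage_hist_eq _ _ pi d d')//.
by move=> j jk; apply: dd'; exact: ltnW.
Qed.

(** * The sigma-algebra of past demand *)

(** Sets that do not separate [w] from [w'] form a sigma-algebra containing the generators. *)
Lemma past_sigma_saturated (d : measure_display) (T : measurableType d)
    (R : realType) (m : nat) (xi : nat -> T -> 'cV[R]_m) (k : nat) (A : set T)
    (w w' : T) :
  past_sigma xi k A -> (forall j, (j <= k)%N -> xi j w = xi j w') -> A w -> A w'.
Proof.
move=> kA ww'; suff : [set B : set T | B w <-> B w'] A by case.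
apply: smallest_sub kA; first split => //=.
- by move=> B BB; split=> -[_ nB]; split => // /BB.
- by move=> B BB; split=> -[n _ /BB Bn]; exists n.
- by move=> _ [j [r [B [jk [_ ->]]]]] /=; rewrite (ww' _ jk).
Qed.

(** The set is an intersection, over finitely many stages and entries, of preimages of
    singletons. *)
Lemma past_sigma_atom (d : measure_display) (T : measurableType d)
    (R : realType) (m : nat) (xi : nat -> T -> 'cV[R]_m) (k : nat) (w0 : T) :
  past_sigma xi k [set w | forall j, (j <= k)%N -> xi j w = xi j w0].
Proof.
set G := [set A | exists (j : nat) (r : 'I_m) (B : set R), (j <= k)%N /\
  measurable B /\ A = (fun w => xi j w r 0) @^-1` B].
have -> : [set w | forall j, (j <= k)%N -> xi j w = xi j w0] =
    \bigcap_(j in [set j | (j <= k)%N]) \bigcap_(r in [set: 'I_m])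
      (fun w => xi j w r 0) @^-1` [set xi j w0 r 0].
  apply/seteqP; split => [w ww0 j jk r _ /=|w ww0 j jk]; first by rewrite ww0.
  by apply/matrixP => r c; rewrite (ord1 c); exact: ww0.
change (measurable ((\bigcap_(j in [set j | (j <= k)%N]) \bigcap_(r in [set: 'I_m])
  (fun w => xi j w r 0) @^-1` [set xi j w0 r 0]) : set (g_sigma_algebraType G))).
apply: bigcap_measurableType => j jk; apply: fin_bigcap_measurable => // r _.
by apply: sub_sigma_algebra; exists j, r, [set xi j w0 r 0].
Qed.

Lemma past_sigma_measurable (d : measure_display) (T : measurableType d)
    (R : realType) (m : nat) (xi : nat -> T -> 'cV[R]_m) (k : nat) (A : set T) :
  (forall j r, (j <= k)%N -> measurable_fun setT (fun w => xi j w r 0)) ->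
  past_sigma xi k A -> measurable A.
Proof.
move=> mxi; apply: smallest_sub; first exact: sigma_algebra_measurable.
move=> _ [j [r [B [jk [mB ->]]]]].
by have := mxi j r jk measurableT B mB; rewrite setTI.
Qed.

(** The level set of [Y] through [w] is a past event, hence saturated. A version is thus constant on
    atoms pointwise, not just almost surely. *)
Lemma cond_exp_past (d : measure_display) (T : measurableType d)
    (R : realType) (P : probability T R) (m : nat) (xi : nat -> T -> 'cV[R]_m)
    (k : nat) (X Y : T -> R) (w w' : T) :
  is_cond_exp P xi k X Y -> (forall j, (j <= k)%N -> xi j w = xi j w') ->
  Y w = Y w'.
Proof.
move=> [mY _ _] ww'.
exact/esym/(past_sigma_saturated (mY _ (measurable_set1 (Y w))) ww').
Qed.

(** * Finite coding of demand paths *)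

Section DemandCode.
Variables (R : realType) (m N : nat) (s : seq 'cV[R]_m).
Implicit Types (x : {ffun 'I_N -> 'I_(size s).+1}) (dem : nat -> 'cV[R]_m).

(* The code [ord_max] and the stages [k >= N] decode to the junk value 0. *)
Definition decode_demand x (k : nat) : 'cV[R]_m :=
  if insub k is Some j then nth 0 s (x j) else 0.

(** A demand missing from [s] has index [size s], which is the junk code [ord_max]. *)
Definition encode_demand dem : {ffun 'I_N -> 'I_(size s).+1} :=
  [ffun j : 'I_N => inord (index (dem j) s)].

(** Truncation stays in the type of full paths, so dependence on the past becomes invariance under
    [past k]. *)
Definition past (k : nat) x : {ffun 'I_N -> 'I_(size s).+1} :=
  [ffun j : 'I_N => if (j <= k)%N then x j else ord_max].

Lemma decode_encode dem k : (k < N)%N -> dem k \in s ->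
  decode_demand (encode_demand dem) k = dem k.
Proof.
move=> kN ks; rewrite /decode_demand insubT ffunE/= inordK ?nth_index//.
by rewrite ltnS index_size.
Qed.

Lemma decode_past x k j : (j <= k)%N -> decode_demand (past k x) j = decode_demand x j.
Proof.
rewrite /decode_demand; case: insubP => // o _ oj jk.
by rewrite ffunE; move: jk; rewrite -oj /= => ->.
Qed.

Lemma past_past x k : past k (past k x) = past k x.
Proof. by apply/ffunP => j; rewrite !ffunE; case: (j <= k)%N. Qed.

Lemma past_last x k : (N <= k.+1)%N -> past k x = x.
Proof.
by move=> Nk; apply/ffunP => j; rewrite ffunE -ltnS (leq_trans (ltn_ord j) Nk).
Qed.

Lemma past_encode_eq dem dem' k : (forall j, (j <= k)%N -> dem j = dem' j) ->
  past k (encode_demand dem) = past k (encode_demand dem').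
Proof.
by move=> dd'; apply/ffunP => j; rewrite !ffunE; case: ifP => // /dd' ->.
Qed.

Lemma past_encode_inj dem dem' k : (k < N)%N ->
  (forall j, (j < N)%N -> dem j \in s) -> (forall j, (j < N)%N -> dem' j \in s) ->
  past k (encode_demand dem) = past k (encode_demand dem') ->
  forall j, (j <= k)%N -> dem j = dem' j.
Proof.
move=> kN ds d's e j jk; have jN := leq_ltn_trans jk kN.
rewrite -(decode_encode jN (ds _ jN)) -(decode_encode jN (d's _ jN)).
by rewrite -(decode_past _ jk) e decode_past.
Qed.

Variables (d : measure_display) (T : measurableType d) (P : probability T R).
Variable xi : nat -> T -> 'cV[R]_m.
Hypothesis xi_s : forall k w, (k < N)%N -> xi k w \in s.

Definition demand_path (w : T) := encode_demand (xi ^~ w).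

Lemma decode_path w k : (k < N)%N -> decode_demand (demand_path w) k = xi k w.
Proof. by move=> kN; rewrite decode_encode ?xi_s. Qed.

Lemma past_path_eqP k w w' : (k < N)%N ->
  past k (demand_path w) = past k (demand_path w') <->
  (forall j, (j <= k)%N -> xi j w = xi j w').
Proof.
move=> kN; split; last exact: past_encode_eq.
by apply: past_encode_inj => // j; exact: xi_s.
Qed.

(** The event is an atom if some outcome has truncated code [x], and empty otherwise. *)
Lemma past_path_event k x : (k < N)%N ->
  past_sigma xi k [set w | past k (demand_path w) == x].
Proof.
move=> kN; have [[w0 <-]|nx] := pselect (exists w, past k (demand_path w) = x).
  rewrite [X in past_sigma _ _ X](_ : _ =
      [set w | forall j, (j <= k)%N -> xi j w = xi j w0]).
    exact: past_sigma_atom.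
  by apply/seteqP; split => w /=; [move=> /eqP /past_path_eqP; exact|
     move=> h; apply/eqP/past_path_eqP].
rewrite [X in past_sigma _ _ X](_ : _ = set0).
  by case: (smallest_sigma_algebra setT [set A | exists (j : nat) (r : 'I_m)
    (B : set R), (j <= k)%N /\ measurable B /\ A = (fun w => xi j w r 0) @^-1` B]).
by apply/seteqP; split => w //= /eqP wx; apply: nx; exists w.
Qed.

(** At stage [N.-1] truncation forgets nothing, so each fibre is a past event. *)
Lemma measurable_path x :
  (forall k r, (k < N)%N -> measurable_fun setT (fun w => xi k w r 0)) ->
  (0 < N)%N -> measurable (demand_path @^-1` [set x]).
Proof.
move=> mxi N0; have N1 : (N.-1 < N)%N by rewrite prednK.
rewrite [X in measurable X](_ : _ = [set w | past N.-1 (demand_path w) == x]).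
  apply: past_sigma_measurable (past_path_event x N1) => j r jN.
  by apply: mxi; rewrite (leq_ltn_trans jN).
by apply/seteqP; split => w /=; rewrite past_last ?prednK// => /eqP.
Qed.

(** Transfers [Y k] to codes by picking an outcome with the same past, with default 0 if there is
    none. For a conditional expectation the choice is immaterial by [cond_exp_past]. *)
Definition on_path (Y : nat -> T -> R) k x : R :=
  if pselect (exists w, past k (demand_path w) = past k x) is left wx
  then Y k (projT1 (cid wx)) else 0.

Lemma on_path_past Y k x : on_path Y k (past k x) = on_path Y k x.
Proof. by rewrite /on_path past_past. Qed.

Lemma on_pathE (X : T -> R) (Y : nat -> T -> R) k w : (k < N)%N ->
  is_cond_exp P xi k X (Y k) -> on_path Y k (demand_path w) = Y k w.
Proof.
move=> kN XY; rewrite /on_path; case: pselect => [wx|]; last by case; exists w.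
by case: cid => w' /= /past_path_eqP/(_)/(cond_exp_past XY); apply.
Qed.

(** Paths are grouped by their past: [phi] is constant on a group, and the group is a past event, to
    which the defining identity of conditional expectation applies. *)
Lemma tower_path (price : nat -> {ffun 'I_N -> 'I_(size s).+1} -> R)
    (X : T -> R) (Y : nat -> T -> R) k phi :
  (forall x, measurable (demand_path @^-1` [set x])) ->
  (k < N)%N -> (forall w, X w = price k.+1 (demand_path w)) ->
  is_cond_exp P xi k X (Y k) -> (forall x, phi (past k x) = phi x) ->
  let p x := fine (P (demand_path @^-1` [set x])) in
  \sum_x p x * (price k.+1 x * phi x) = \sum_x p x * (on_path Y k x * phi x).
Proof.
move=> mpath kN Xprice XY phi_past p.
rewrite (partition_big (past k) predT)//= [RHS](partition_big (past k) predT)//=.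
apply: eq_bigr => a _.
have fiber (q : _ -> R) : \sum_(x | past k x == a) p x * (q x * phi x) =
    (\sum_(x | past k x == a) p x * q x) * phi a.
  by rewrite mulr_suml; apply: eq_bigr => x /eqP <-; rewrite phi_past mulrA.
rewrite !fiber; congr (_ * _).
apply: EFin_inj; rewrite -(integral_finite_code P mpath (fun x => past k x == a)).
rewrite -(integral_finite_code P mpath (fun x => past k x == a)).
case: XY (XY) => _ _ XYA XY; rewrite /=.
under eq_integral => w _ do rewrite -Xprice.
rewrite -XYA; last exact: past_path_event.
by apply: eq_integral => w _; rewrite (on_pathE _ kN XY).
Qed.

End DemandCode.

(** * Storage capacity at a single node *)

Lemma storage_set_axis (R : realType) (m : nat) (i : 'I_m) (t : R) (z : 'cV[R]_m) :
  storage_set (t *: delta_mx i 0) z ->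
  z = z i 0 *: delta_mx i 0 /\ 0 <= z i 0 <= t.
Proof.
move=> bz; split; last by have := bz i; rewrite !mxE !eqxx mulr1.
apply/matrixP => j q; rewrite (ord1 q) !mxE eqxx andbT.
case: eqVneq => [->|/negbTE ji]; rewrite ?mulr1// mulr0.
by apply/eqP; rewrite eq_le andbC; have := bz j; rewrite !mxE ji mulr0.
Qed.

(** The injection [v_of pi dem k] is feasible for dispatch at demand plus control, and the control
    moves along axis [i] by less than [e], where the dispatch value is affine. *)
Lemma stage_cost_ge (R : realType) (m l : nat) (G : network R m l)
    (f : 'cV[R]_l) (alpha beta : 'I_m -> R) (pi : policy R m)
    (dem : nat -> 'cV[R]_m) (k : nat) (i : 'I_m) (e t g : R) :
  (forall x, dispatch_attained G f alpha beta x) -> 0 <= t -> t < e ->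
  (forall s, `|s| < e ->
    dispatch_value G f alpha beta (dem k + s *: delta_mx i 0) =
    dispatch_value G f alpha beta (dem k) + g * s) ->
  (forall j, (j <= k)%N -> storage_set (t *: delta_mx i 0) (storage pi dem j.+1)) ->
  injection_polytope G f (v_of pi dem k - u_of pi dem k - dem k) ->
  dispatch_value G f alpha beta (dem k) +
    g * (storage pi dem k.+1 i 0 - storage pi dem k i 0) <=
  cost alpha beta (v_of pi dem k).
Proof.
move=> att t0 te affine zb vP.
have [zS /andP[zS0 zSt]] := storage_set_axis (zb k (leqnn k)).
have [z /andP[z0 zt]] : storage pi dem k = storage pi dem k i 0 *: delta_mx i 0 /\
    0 <= storage pi dem k i 0 <= t.
  (* [zb] covers levels reached after a stage; the level entering stage 0 is the initial 0. *)
  case: k zb {affine vP zS zS0 zSt} => [|k] zb; last first.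
    exact: storage_set_axis (zb k (leqnSn k)).
  by rewrite storage0 mxE lexx scale0r.
rewrite -affine; last by rewrite ltr_norml; apply/andP; split; lra.
have -> : (storage pi dem k.+1 i 0 - storage pi dem k i 0) *: delta_mx i 0 =
    u_of pi dem k.
  by rewrite scalerBl -zS -z storageS addrAC subrr add0r.
by apply: dispatch_value_le => //; rewrite /dispatch_feasible /= opprD addrA addrAC.
Qed.

(** Prescribing the next level from the demand history alone gives the storage path in closed form;
    the control is the jump to that level. *)
Definition target_policy (R : realType) (m : nat)
    (target : forall k, k.+1.-tuple 'cV[R]_m -> 'cV[R]_m)
    (dispatch : 'cV[R]_m -> 'cV[R]_m) : policy R m :=
  Policy (fun k zs ds => target k ds - tnth zs ord_max)
    (fun k zs ds => dispatch (tnth ds ord_max + (target k ds - tnth zs ord_max))).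

Lemma storage_target (R : realType) (m : nat)
    (target : forall k, k.+1.-tuple 'cV[R]_m -> 'cV[R]_m)
    (dispatch : 'cV[R]_m -> 'cV[R]_m) (dem : nat -> 'cV[R]_m) (k : nat) :
  storage (target_policy target dispatch) dem k.+1 = target k (demand_hist dem k).
Proof. by rewrite storageS /u_of /= addrC subrK. Qed.

Lemma v_of_target (R : realType) (m : nat)
    (target : forall k, k.+1.-tuple 'cV[R]_m -> 'cV[R]_m)
    (dispatch : 'cV[R]_m -> 'cV[R]_m) (dem : nat -> 'cV[R]_m) (k : nat) :
  let pi := target_policy target dispatch in
  v_of pi dem k = dispatch (dem k + u_of pi dem k).
Proof. by rewrite /= /v_of/= tnth_mktuple. Qed.

(** * Affine optimal cost for small capacity *)

Theorem theorem2 (R : realType)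
    (m l : nat) (G : network R m l) (f : 'cV[R]_l) (f_ge0 : nonneg_vec f)
    (alpha beta : 'I_m -> R) (cost_coef : forall i, 0 <= beta i <= alpha i)
    (attained : forall x : 'cV[R]_m, dispatch_attained G f alpha beta x)
    (lam : 'cV[R]_m -> 'cV[R]_m)
    (lam_opt : forall x : 'cV[R]_m, optimal_multiplier G f alpha beta x (lam x))
    (nL : nat) (K : set 'cV[R]_m) (S : 'I_nL -> set 'cV[R]_m)
    (part : price_partition (dispatch_value G f alpha beta) lam K S)
    (Xi : set 'cV[R]_m) (Xi_int : Xi `<=` K°)
    (Xi_fin : finite_set Xi) (Xi_bd : Xi `&` partition_boundary S = set0)
    (N : nat) (N_gt0 : (0 < N)%N)
    (d : measure_display) (T : measurableType d) (P : probability T R)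
    (xi : nat -> T -> 'cV[R]_m)
    (xi_meas : forall k r, (k < N)%N -> measurable_fun setT (fun w => xi k w r 0))
    (xi_val : forall k w, (k < N)%N -> Xi (xi k w))
    (lamhat : nat -> T -> 'cV[R]_m)
    (lamhat_cond : forall k r, (k.+1 < N)%N ->
       is_cond_exp P xi k (fun w => lam (xi k.+1 w) r 0) (fun w => lamhat k w r 0))
    (i : 'I_m) :
  let Jstar := optimal_cost P N G f alpha beta xi in
  let LMV := (- right_partial0 Jstar i)%E in
  let price k w := lam (xi k w) i 0 in
  [/\ cvg (coord_quotient Jstar i t @[t --> 0^'+]),
      LMV = 'E_P[fun w =>
        (\sum_(k < N.-1) pos (lamhat k w i 0 - price k w))%R]%E &
      (LMV <= (2^-1)%:E * 'E_P[fun w => total_variation_seq N (price ^~ w)]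
              + (2^-1)%:E * 'E_P[fun w => (price N.-1 w - price 0%N w)%R])%E].
Proof.
case: N N_gt0 xi_meas xi_val lamhat_cond => [//|n] _ xi_meas xi_val lamhat_cond.
move=> Jstar LMV price.
have [s Xis] := (finite_seqP Xi).1 Xi_fin.
pose Q := dispatch_value G f alpha beta.
have xi_s k w : (k < n.+1)%N -> xi k w \in s.
  by move=> kn; have := xi_val k w kn; rewrite Xis.
have interior y : y \in s -> exists j, (S j)° y.
  move=> ys; have Xiy : Xi y by rewrite Xis.
  have : K y by exact: interior_subset (Xi_int _ Xiy).
  rewrite -(pp_cover part) => -[j _ Sjy]; exists j.
  apply: contrapT => nSjy; have : (Xi `&` partition_boundary S) y.
    by split => //; exists j.
  by rewrite Xi_bd.
have lam_ge0 y : y \in s -> 0 <= lam y i 0.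
  by move=> /interior[j Sjy]; exact: pp_nonneg part _ _ Sjy i.
(* The common radius is built by induction on [s], as a minimum of radii. *)
have [e e0 affine] : exists2 e : R, 0 < e & forall y r, y \in s -> `|r| < e ->
    Q (y + r *: delta_mx i 0) = Q y + lam y i 0 * r.
  elim: {Xis xi_s lam_ge0} s interior => [|y s IH] interior; first by exists 1.
  have [|e e0 eQ] := IH; first by move=> z zs; apply: interior; rewrite inE zs orbT.
  have [j Sjy] := interior y (mem_head _ _).
  have [a [c Qac]] := pp_affine part j.
  have [e' e'0 e'Q] := affine_along_axis i Sjy Qac (pp_grad part Sjy).
  exists (Num.min e e'); first by rewrite lt_min e0.
  move=> z r; rewrite inE lt_min => /orP[/eqP ->|zs] /andP[re re'].
    exact: e'Q.
  exact: eQ.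
pose cw := demand_path n.+1 s xi.
pose p x := fine (P (cw @^-1` [set x])).
have mcw x : measurable (cw @^-1` [set x]) by exact: measurable_path.
pose q k (x : {ffun 'I_n.+1 -> 'I_(size s).+1}) := lam (decode_demand x k) i 0.
pose hat := @on_path _ _ n.+1 s _ _ xi (fun k w => lamhat k w i 0).
have hatE k w : (k < n)%N -> hat k (cw w) = lamhat k w i 0.
  by move=> kn; apply: on_pathE (lamhat_cond k i kn) => //; exact: ltnW.
have qE k w : (k < n.+1)%N -> q k (cw w) = price k w.
  by move=> kn; rewrite /q /cw decode_path.
have p_ge0 x : 0 <= p x by rewrite fine_ge0.
(* Only realised paths carry weight. Codes with junk demands might violate [lam_ge0] or [affine],
   and this excludes them. *)
have p_path x : p x != 0 -> exists w, x = cw w.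
  apply: (ae_finite_code mcw (A := fun x => exists w, x = cw w)).
  by apply: aeW => w; exists w.
have q_past k x : q k (past k x) = q k x by rewrite /q decode_past.
have hat_past k x : hat k (past k x) = hat k x by exact: on_path_past.
have tower k phi : (k < n)%N -> (forall x, phi (past k x) = phi x) ->
    \sum_x p x * (q k.+1 x * phi x) = \sum_x p x * (hat k x * phi x).
  move=> kn; apply: (tower_path xi_s mcw _ _ (lamhat_cond k i kn)); first exact: ltnW.
  by move=> w; rewrite [RHS](qE k.+1 w kn).
pose L := lmv_sum p n q hat.
pose C := \sum_x p x * \sum_(k < n.+1) Q (decode_demand x k).
have JstarE t : 0 <= t < e -> Jstar (t *: delta_mx i 0) = (C - t * L)%:E.
  move=> /andP[t0 te].
  have CE z : \sum_x p x * \sum_(k < n.+1) (Q (decode_demand x k) +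
      q k x * (z k.+1 x - z k x)) =
      C + \sum_x p x * \sum_(k < n.+1) q k x * (z k.+1 x - z k x).
    by rewrite /C -big_split; apply: eq_bigr => x _; rewrite big_split mulrDr.
  (* A threshold policy gives the upper bound; the lower bound is then shown for every admissible
     policy. *)
  apply/le_anti/andP; split.
    have /choice[dispatch dispatchP] y : exists v, dispatch_feasible G f y v /\
        cost alpha beta v = Q y.
      by have [v] := dispatch_value_attained (attained y); exists v.
    pose z k (x : {ffun 'I_n.+1 -> 'I_(size s).+1}) : R :=
      if k is j.+1 then if (j < n)%N && (q j x < hat j x) then t else 0 else 0.
    have z_past k x x' : past k x = past k x' -> z k.+1 x = z k.+1 x'.
      move=> xx' /=; rewrite -(q_past k x) -(hat_past k x) xx'.
      by rewrite (q_past k x') (hat_past k x').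
    have z_bnd k x : 0 <= z k x <= t.
      by case: k => [|k] /=; [|case: ifP]; rewrite lexx t0.
    (* Only [k.+1] demands are known; [nth 0] pads the rest, harmlessly since [z k.+1] depends on
       the past only. *)
    pose target k (ds : k.+1.-tuple 'cV[R]_m) : 'cV[R]_m :=
      z k.+1 (encode_demand n.+1 s (nth 0 ds)) *: delta_mx i 0.
    pose pi := target_policy target dispatch.
    have storageE w k : storage pi (xi ^~ w) k = z k (cw w) *: delta_mx i 0.
      case: k => [|k]; first by rewrite storage0 scale0r.
      rewrite storage_target /target (z_past k _ (cw w))//.
      apply: past_encode_eq => j jk.
      by rewrite -(tnth_nth 0 _ (Ordinal (jk : (j < k.+1)%N))) tnth_mktuple.
    have uE w k : u_of pi (xi ^~ w) k =
        (z k.+1 (cw w) - z k (cw w)) *: delta_mx i 0.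
      by rewrite scalerBl -!storageE storageS addrAC subrr add0r.
    apply: ereal_inf_lbound; exists pi.
      move=> k kn; apply: aeW => w; split.
        rewrite -storageS storageE => j; rewrite !mxE eqxx andbT.
        by case: (j == i); rewrite ?mulr1 ?mulr0 ?lexx// z_bnd.
      rewrite v_of_target; have [+ _] := dispatchP (xi k w + u_of pi (xi ^~ w) k).
      by rewrite /dispatch_feasible /= opprD addrA addrAC.
    rewrite /policy_cost (expectation_finite_code P mcw (phi := fun x =>
      \sum_(k < n.+1) (Q (decode_demand x k) + q k x * (z k.+1 x - z k x)))).
      rewrite CE (trading_sum_threshold (t := t) q_past hat_past tower)//.
    move=> w; apply: eq_bigr => k _; rewrite v_of_target (dispatchP _).2 uE.
    rewrite affine ?xi_s//; first by rewrite decode_path// qE.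
    (* Both levels lie between 0 and [t], so their difference stays below the radius [e]. *)
    have := z_bnd k (cw w); have := z_bnd k.+1 (cw w).
    by rewrite ltr_norml; move=> /andP[? ?] /andP[? ?]; apply/andP; split; lra.
  apply: le_ereal_inf_tmp => _ [pi adm <-].
  pose z k (x : {ffun 'I_n.+1 -> 'I_(size s).+1}) :=
    storage pi (decode_demand x) k i 0.
  rewrite /policy_cost (expectation_finite_code P mcw (phi := fun x =>
    \sum_(k < n.+1) cost alpha beta (v_of pi (decode_demand x) k))); last first.
    (* By causality only stages within the horizon matter, where decoding is faithful. *)
    move=> w; apply: eq_bigr => k _; congr cost; apply: v_of_eq => j jk.
    by rewrite decode_path// (leq_ltn_trans jk).
  have stageP k x : (k < n.+1)%N -> p x != 0 ->
      storage_set (t *: delta_mx i 0) (storage pi (decode_demand x) k.+1) /\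
      injection_polytope G f (v_of pi (decode_demand x) k -
        u_of pi (decode_demand x) k - decode_demand x k).
    move=> kn; move: x; apply: (ae_finite_code mcw).
    apply: filterS (adm k kn) => w.
    have cwE j : (j <= k)%N -> decode_demand (cw w) j = xi j w.
      by move=> jk; rewrite decode_path// (leq_ltn_trans jk).
    rewrite -storageS (storage_eq pi (d' := xi ^~ w))// (u_of_eq pi (d' := xi ^~ w))//.
    by rewrite (v_of_eq pi (d' := xi ^~ w))// cwE.
  rewrite lee_fin; apply: (@le_trans _ _ (\sum_x p x * \sum_(k < n.+1)
      (Q (decode_demand x k) + q k x * (z k.+1 x - z k x)))).
    rewrite CE lerD2l; apply: (trading_sum_ge p_ge0 tower) => //.
    - by move=> x /p_path[w ->]; rewrite qE// lam_ge0// xi_s.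
    - by move=> x; rewrite /z storage0 mxE.
    - move=> k x; rewrite /z (storage_eq pi (d' := decode_demand x))// => j jk.
      by rewrite decode_past.
    - by move=> k x px kn; case: (storage_set_axis (stageP k x kn px).1).
  apply: ler_sum => x _; rewrite -/(p x).
  have [->|px] := eqVneq (p x) 0; first by rewrite !mul0r.
  rewrite ler_wpM2l//; apply: ler_sum => k _; apply: (stage_cost_ge attained t0 te).
  - have [w ->] := p_path _ px; rewrite decode_path// => r re.
    by rewrite [LHS]affine ?xi_s// qE.
  - by move=> j jk; apply: (stageP _ _ _ px).1; rewrite (leq_ltn_trans jk).
  - exact: (stageP _ _ _ px).2.
(* For [0 < t < e] the quotient is exactly [- L], hence so is its limit. *)
have quotE : \forall t \near 0^'+, coord_quotient Jstar i t = (- L)%:E.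
  near=> t; have t0 : 0 < t by near: t; exact: nbhs_right_gt.
  rewrite /coord_quotient JstarE; last first.
    by rewrite ltW//=; near: t; exact: nbhs_right_lt.
  have := JstarE 0; rewrite scale0r lexx e0 => -> //.
  by rewrite -EFinB -EFinM; congr EFin; field; rewrite gt_eqF.
have LMVE : LMV = L%:E.
  by rewrite /LMV /right_partial0 (lim_near_cst _ quotE)// EFinN oppeK.
split.
- exact: is_cvg_near_cst quotE.
- rewrite LMVE (expectation_finite_code P mcw
    (phi := fun x => \sum_(k < n) pos (hat k x - q k x)))// => w.
  by apply: eq_bigr => k _; rewrite hatE// qE// ltnS ltnW.
- rewrite LMVE (expectation_finite_code P mcw
    (phi := fun x => \sum_(k < n) `|q k.+1 x - q k x|)); last first.
    move=> w; apply: eq_bigr => k _.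
    by rewrite !qE ?ltnS// ltnW.
  rewrite (expectation_finite_code P mcw (phi := fun x => q n x - q 0%N x)).
    by rewrite -!EFinM -EFinD lee_fin; exact: lmv_sum_le.
  by move=> w; rewrite !qE.
Unshelve. all: by end_near. Qed.
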